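(* Let $\Sigma$ be a compact group with probability Haar measure $\mu$, let $\mathcal H\neq\{0\}$ be a complex Hilbert space, and let $\pi:\Sigma\to\mathbb B(\mathcal H)$ be a (strongly continuous) unitary representation. Then $\pi\in\mathrm{SQ}(\mathbb B(\mathcal H),c\,\mu)$ for some constant $c>0$ if and only if $\pi$ is an irreducible representation.
   Context: Inner products are linear in the first variable and antilinear in the second. For a complex Hilbert space $\mathcal H$ and a measure space $(\Sigma,\mathcal M,\mu)$ ($\mu$ a positive measure), $\mathrm{SQ}(\mathbb B(\mathcal H),\mu)$ denotes the set of all almost everywhere defined, weakly measurable maps $\pi:\Sigma\to\mathbb B(\mathcal H)$ (i.e. $s\mapsto\langle\pi(s)u,v\rangle$ is measurable for all $u,v\in\mathcal H$) such that $$\int_\Sigma\langle\pi(s)u_1,v_1\rangle\langle v_2,\pi(s)u_2\rangle\,d\mu(s)=\langle u_1,u_2\rangle\langle v_2,v_1\rangle\quad\text{for all }u_1,u_2,v_1,v_2\in\mathcal H.$$ *)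

(* Defs.v *)
From HB Require Import structures.
From mathcomp Require Import all_boot all_order all_algebra.
From mathcomp Require Import complex sesquilinear.
From mathcomp Require Import all_classical all_reals all_analysis.

Set Implicit Arguments.
Unset Strict Implicit.
Unset Printing Implicit Defensive.

Import Order.TTheory GRing.Theory Num.Theory.
Import numFieldNormedType.Exports.

Local Open Scope classical_set_scope.
Local Open Scope complex_scope.
Local Open Scope ring_scope.

HB.mixin Record isTopologicalGroup G & PointedTopological G & Group G := {
  mulg_continuous : continuous (fun x : G * G => (x.1 * x.2)%g) ;
  invg_continuous : continuous (fun x : G => (x^-1)%g) ;
}.

(* Pointedness costs nothing, since a group is inhabited; the library needs it
   to build the measurable space generated by the open sets. The distinguished
   point is not required to be the unit. *)
#[short(type="topologicalGroupType")]
HB.structure Definition TopologicalGroup :=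
  {G of PointedTopological G & Group G & isTopologicalGroup G}.

(* The underlying set of G with its Borel sigma-algebra. *)
Notation borel G := (g_sigma_algebraType (@open G)).

Section haar.
Context (R : realType) (G : topologicalGroupType).
Implicit Types (mu : {measure set (borel G) -> \bar R}) (A : set (borel G)).

Definition left_invariant mu := forall (g : G) A, measurable A ->
  mu ((fun x : G => (g * x)%g) @` A) = mu A.

Definition regular_borel mu :=
  (forall A, measurable A ->
     mu A = ereal_inf [set mu U | U in [set U : set G | open U /\ A `<=` U]]) /\
  (forall U : set G, open U ->
     mu U = ereal_sup [set mu K | K in [set K : set G | compact K /\ K `<=` U]]).

Definition haar mu := left_invariant mu /\ regular_borel mu.

End haar.

(* {dot H for Num.conj} is the type of positive definite hermitian forms, linear
   in the first variable and antilinear in the second. The norm, hence the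
   topology, of H is the one of the inner product. *)
HB.mixin Record CompleteNormedModule_isHilbert (R : realType) H
    & CompleteNormedModule R[i] H := {
  inner : {dot H for Num.conj} ;
  sqr_norm_inner : forall u : H, `|u| ^+ 2 = inner u u ;
}.

#[short(type="hilbertType")]
HB.structure Definition Hilbert (R : realType) :=
  {H of CompleteNormedModule R[i] H & CompleteNormedModule_isHilbert R H}.

Notation "⟨ u , v ⟩" := (inner u v)
  (at level 0, u, v at level 99, format "⟨ u ,  v ⟩") : ring_scope.

Section bounded_operators.
Context (R : realType) (H : hilbertType R).

Record bounded_op := BoundedOp {
  bounded_op_fun :> {linear H -> H} ;
  bounded_opP : exists M : R, forall u : H, `|bounded_op_fun u| <= M%:C * `|u| ;
}.

Definition unitary (A : bounded_op) :=
  (forall u v : H, ⟨A u, A v⟩ = ⟨u, v⟩) /\ (forall v : H, exists u : H, A u = v).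

End bounded_operators.

Section representations.
Context (R : realType) (G : topologicalGroupType) (H : hilbertType R).
Implicit Types pi : G -> bounded_op H.

Definition unitary_representation pi :=
  [/\ forall u : H, pi 1%g u = u,
      forall (s t : G) (u : H), pi (s * t)%g u = pi s (pi t u),
      forall s : G, unitary (pi s) &
      forall u : H, continuous (fun s : G => pi s u)].

Definition closed_subspace (M : set H) :=
  [/\ closed M, M 0 &
      forall (a : R[i]) (u v : H), M u -> M v -> M (a *: u + v)].

Definition irreducible pi := forall M : set H, closed_subspace M ->
  (forall (s : G) (u : H), M u -> M (pi s u)) -> M = [set 0] \/ M = setT.

End representations.

Section complex_integral.
Context d (T : measurableType d) (R : realType).
Implicit Types (mu : {measure set T -> \bar R}) (D : set T) (f : T -> R[i]).

Definition cmeasurable_fun D f :=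
  measurable_fun D (fun s => complex.Re (f s)) /\
  measurable_fun D (fun s => complex.Im (f s)).

(* f is integrable over D, with integral z. *)
Definition is_cintegral mu D f (z : R[i]) :=
  [/\ mu.-integrable D (fun s => (complex.Re (f s))%:E),
      mu.-integrable D (fun s => (complex.Im (f s))%:E),
      (\int[mu]_(s in D) (complex.Re (f s))%:E = (complex.Re z)%:E)%E &
      (\int[mu]_(s in D) (complex.Im (f s))%:E = (complex.Im z)%:E)%E].

End complex_integral.

Section SQ.
Context d (T : measurableType d) (R : realType) (H : hilbertType R).
Implicit Types pi : T -> option (bounded_op H).

(* A partially defined map takes the value None where it is undefined. *)
Definition domain pi : set T := [set s | isSome (pi s)].

(* s |-> F (pi s); the value 0 outside of the domain of pi plays no role. *)
Definition on_domain pi (F : bounded_op H -> R[i]) (s : T) : R[i] :=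
  if pi s is Some A then F A else 0.

Definition SQ (mu : {measure set T -> \bar R}) :
    set (T -> option (bounded_op H)) :=
  [set pi |
    [/\ measurable (domain pi),
        mu (~` domain pi) = 0%E,
        forall u v : H,
          cmeasurable_fun (domain pi) (on_domain pi (fun A => ⟨A u, v⟩)) &
        forall u1 u2 v1 v2 : H,
          is_cintegral mu (domain pi)
            (on_domain pi (fun A => ⟨A u1, v1⟩ * ⟨v2, A u2⟩))
            (⟨u1, u2⟩ * ⟨v2, v1⟩)]].

End SQ.

(* Main.v *)
Require Import Defs.
From HB Require Import structures.
From mathcomp Require Import all_boot all_order all_algebra.
From mathcomp Require Import complex sesquilinear.
From mathcomp Require Import all_classical all_reals all_analysis.
From mathcomp Require Import measurable_realfun ring lra.

Set Implicit Arguments.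
Unset Strict Implicit.
Unset Printing Implicit Defensive.

Import Order.TTheory GRing.Theory Num.Theory.
Import numFieldNormedType.Exports.

Local Open Scope classical_set_scope.
Local Open Scope ring_scope.

(** The proof rests on the quadratic form of v obtained, for a vector u, by
    averaging the squared modulus of <v, pi s u> over s. Left invariance of the
    Haar measure makes it invariant under the representation.

    Let pi be irreducible. The orbit of u is compact, hence the form is that of a
    compact positive operator, and it attains its maximum l on the unit sphere
    (compact_form_max). The vectors v on which it equals l |v|^2 form a nonzero
    closed invariant subspace, hence all of H (irreducible_coefficient_form). By
    the Bessel inequality the values of the form on an orthonormal family have a
    sum at most |u|^2; each of them is l, and l > 0 if u is nonzero, so H has a
    finite dimension n. On an orthonormal basis the sum is exactly |u|^2, so
    l = |u|^2 / n. Thus n times the form is |u|^2 |v|^2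
    (irreducible_schur_relation), and polarizing in both pairs of variables
    yields the identity of SQ with c = n.

    Conversely, the diagonal case of the identity of SQ gives the same relation
    with constant c. As before it bounds the length of orthonormal families, so
    that a closed invariant subspace M has a finite orthonormal basis. If u is a
    nonzero vector of M and w is orthogonal to M, the coefficients <w, pi s u>
    vanish, so |u|^2 |w|^2 = 0 and w = 0; hence M = H
    (schur_relation_irreducible). *)

(** * Squared modulus and inner product *)

Section modulus.
Context (R : realType).
Implicit Types z w : R[i].

Definition sqmod z : R := complex.Re z ^+ 2 + complex.Im z ^+ 2.

Lemma sqmod_ge0 z : 0 <= sqmod z.
Proof. by rewrite addr_ge0 ?sqr_ge0. Qed.

Lemma sqmodE z : (sqmod z)%:C%C = z * z^*.
Proof. by rewrite /sqmod add_Re2_Im2 normCK. Qed.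

Lemma sqmod_norm z : (sqmod z)%:C%C = `|z| ^+ 2.
Proof. exact: add_Re2_Im2. Qed.

Lemma sqmodM z w : sqmod (z * w) = sqmod z * sqmod w.
Proof. by apply: complexI; rewrite rmorphM/= !sqmod_norm normrM exprMn. Qed.

Lemma sqmod_conj z : sqmod z^* = sqmod z.
Proof. by apply: complexI; rewrite !sqmod_norm norm_conjC. Qed.

Lemma sqmod_parallelogram z w :
  sqmod (z + w) + sqmod (z - w) = 2 * sqmod z + 2 * sqmod w.
Proof. by case: z w => [a b] [c d]; rewrite /sqmod /=; ring. Qed.

Lemma sqmod_real (x : R) : sqmod x%:C%C = x ^+ 2.
Proof. by rewrite /sqmod /= expr0n addr0. Qed.

End modulus.

Section inner_product.
Context (R : realType) (H : hilbertType R).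
Implicit Types u v w : H.

Definition sqnorm v : R := complex.Re ⟨v, v⟩.

Lemma innerDl u v w : ⟨u + v, w⟩ = ⟨u, w⟩ + ⟨v, w⟩.
Proof. exact: linearDl. Qed.

Lemma innerDr u v w : ⟨u, v + w⟩ = ⟨u, v⟩ + ⟨u, w⟩.
Proof. exact: linearDr. Qed.

Lemma innerNl u v : ⟨- u, v⟩ = - ⟨u, v⟩.
Proof. exact: linearNl. Qed.

Lemma innerNr u v : ⟨u, - v⟩ = - ⟨u, v⟩.
Proof. exact: linearNr. Qed.

Lemma innerZl a u v : ⟨a *: u, v⟩ = a * ⟨u, v⟩.
Proof. exact: linearZl_LR. Qed.

Lemma innerZr a u v : ⟨u, a *: v⟩ = a^* * ⟨u, v⟩.
Proof. exact: linearZr_LR. Qed.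

Lemma inner0l v : ⟨0, v⟩ = 0.
Proof. exact: linear0l. Qed.

Lemma inner_conj u v : ⟨u, v⟩^* = ⟨v, u⟩.
Proof. by rewrite [RHS]hermC /= expr0 mul1r. Qed.

Lemma inner_sqnorm v : ⟨v, v⟩ = (sqnorm v)%:C%C.
Proof.
have := dnorm_ge0 (@inner R H) v; rewrite /sqnorm.
by case: (⟨v, v⟩) => a b; rewrite lecE /= => /andP[/eqP -> _].
Qed.

Lemma sqnorm_ge0 v : 0 <= sqnorm v.
Proof. by rewrite -ler0c -inner_sqnorm dnorm_ge0. Qed.

Lemma sqnorm_eq0 v : (sqnorm v == 0) = (v == 0).
Proof.
by rewrite -(dnorm_eq0 (@inner R H)) inner_sqnorm eq_complex /= eqxx andbT.
Qed.

Lemma sqnorm_gt0 v : (0 < sqnorm v) = (v != 0).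
Proof. by rewrite lt_neqAle sqnorm_ge0 andbT eq_sym sqnorm_eq0. Qed.

Lemma sqnorm_norm v : (sqnorm v)%:C%C = `|v| ^+ 2.
Proof. by rewrite sqr_norm_inner inner_sqnorm. Qed.

Lemma sqnormZ a v : sqnorm (a *: v) = sqmod a * sqnorm v.
Proof.
apply: complexI.
by rewrite rmorphM /= -!inner_sqnorm innerZl innerZr sqmodE mulrA.
Qed.

Lemma sqnorm_parallelogram u v :
  sqnorm (u + v) + sqnorm (u - v) = 2 * sqnorm u + 2 * sqnorm v.
Proof.
rewrite /sqnorm !(innerDl, innerDr, innerNl, innerNr).
rewrite !raddfD /= !raddfN /=; lra.
Qed.

Lemma sqnormB_Re u v :
  sqnorm (u - v) = sqnorm u + sqnorm v - 2 * complex.Re ⟨u, v⟩.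
Proof.
rewrite /sqnorm !(innerDl, innerDr, innerNl, innerNr).
rewrite !raddfD /= !raddfN /=.
have -> : complex.Re ⟨u, v⟩ = complex.Re ⟨v, u⟩.
  by rewrite -inner_conj; case: (⟨v, u⟩).
lra.
Qed.

Lemma cauchy_schwarz u v : sqmod ⟨u, v⟩ <= sqnorm u * sqnorm v.
Proof.
have [v0|v0] := eqVneq v 0.
  by rewrite v0 -inner_conj inner0l sqmod_conj /sqmod /sqnorm inner0l
     /= expr0n addr0 mulr0.
(* the squared distance from u to the line of v, cleared of denominators *)
have := sqnorm_ge0 ((sqnorm v)%:C%C *: u - ⟨u, v⟩ *: v).
rewrite sqnormB_Re !sqnormZ sqmod_real innerZl innerZr [_^* * _]mulrC -sqmodE.
rewrite -rmorphM /= => h.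
have c0 : 0 < sqnorm v by rewrite sqnorm_gt0.
rewrite -(ler_pM2l c0); lra.
Qed.

Lemma sqnorm_lt v (e : R) : 0 < e -> (sqnorm v < e ^+ 2) = (`|v| < e%:C%C).
Proof.
move=> e0; rewrite -ltcR sqnorm_norm rmorphXn /= ltr_pXn2r// nnegrE//.
by rewrite ler0c ltW.
Qed.

Lemma cvg_sqnorm (F : set_system H) (l : H) : Filter F ->
  (F --> l) <-> forall e : R, 0 < e -> \forall v \near F, sqnorm (l - v) < e.
Proof.
move=> FF; split=> [/cvgrPdist_lt Fl e e0|Fl].
  have s0 : 0 < Num.sqrt e by rewrite sqrtr_gt0.
  have /Fl : 0 < (Num.sqrt e)%:C%C :> R[i] by rewrite ltcR.
  apply: filterS => v; rewrite -sqnorm_lt// sqr_sqrtr//; exact: ltW.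
apply/cvgrPdist_lt => -[e e']; rewrite ltcE /= => /andP[/eqP -> e0].
by apply: filterS (Fl _ (exprn_gt0 2 e0)) => v; rewrite sqnorm_lt.
Qed.

Lemma cauchy_sqnorm (F : set_system H) : ProperFilter F ->
  (forall e : R, 0 < e -> exists2 A, F A &
     forall v w, A v -> A w -> sqnorm (v - w) < e) ->
  exists l : H, F --> l.
Proof.
move=> FF Fc; suff /cauchy_cvg : cauchy F.
  by move=> Fl; exists (lim F).
apply/cauchy_exP => -[e e']; rewrite ltcE /= => /andP[/eqP -> e0].
have [A FA hA] := Fc _ (exprn_gt0 2 e0).
have [v Av] := filter_ex FA.
exists v; apply: filterS FA => w Aw; rewrite -ball_normE /=.
by rewrite -sqnorm_lt// hA.
Qed.

End inner_product.

(** * Orthonormal families *)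

Section orthonormal_families.
Context (R : realType) (H : hilbertType R).
Implicit Types (u v w : H) (e : nat -> H) (n : nat).

(** Families are total functions on nat of which only the first n values matter:
    enlarging one by a vector then involves no dependent type. *)
Definition orthonormal_upto n e :=
  forall i j, (i < n)%N -> (j < n)%N -> ⟨e i, e j⟩ = (i == j)%:R.

Definition fourier_sum n e v := \sum_(i < n) ⟨v, e i⟩ *: e i.

Lemma inner_suml n (f : 'I_n -> H) v :
  ⟨\sum_(i < n) f i, v⟩ = \sum_(i < n) ⟨f i, v⟩.
Proof. exact: linear_sumlz. Qed.

Lemma inner_fourier_sum n e v w :
  ⟨fourier_sum n e v, w⟩ = \sum_(i < n) ⟨v, e i⟩ * ⟨e i, w⟩.
Proof. by rewrite inner_suml; apply: eq_bigr => i _; rewrite innerZl. Qed.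

Lemma fourier_residual_orthogonal n e v i : orthonormal_upto n e ->
  (i < n)%N -> ⟨v - fourier_sum n e v, e i⟩ = 0.
Proof.
move=> on_e lt_in; rewrite innerDl innerNl inner_fourier_sum.
rewrite (bigD1 (Ordinal lt_in))//= on_e// eqxx mulr1 big1 ?addr0 ?subrr//.
move=> j ji; rewrite on_e// -val_eqE/= in ji *.
by rewrite (negbTE ji) mulr0.
Qed.

(** The residual is orthogonal to the fourier sum, so this is Pythagoras; it
    contains both Bessel (the residual has nonnegative norm) and Parseval (the
    residual vanishes). *)
Lemma sqnorm_fourier_residual n e v : orthonormal_upto n e ->
  sqnorm (v - fourier_sum n e v) = sqnorm v - \sum_(i < n) sqmod ⟨v, e i⟩.
Proof.
move=> on_e; apply: complexI; rewrite -inner_sqnorm rmorphB /= -inner_sqnorm.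
set w := v - _.
have -> : ⟨w, w⟩ = ⟨w, v⟩.
  rewrite {2}/w innerDr innerNr -[X in _ - X]inner_conj inner_fourier_sum.
  rewrite big1 ?conjC0 ?subr0// => i _.
  by rewrite -[⟨e i, w⟩]inner_conj fourier_residual_orthogonal// conjC0 mulr0.
rewrite /w innerDl innerNl inner_fourier_sum rmorph_sum /=.
by congr (_ - _); apply: eq_bigr => i _; rewrite sqmodE inner_conj.
Qed.

Lemma bessel n e v : orthonormal_upto n e ->
  \sum_(i < n) sqmod ⟨v, e i⟩ <= sqnorm v.
Proof.
by move=> on_e; rewrite -subr_ge0 -sqnorm_fourier_residual// sqnorm_ge0.
Qed.

Lemma orthonormal_extend n e w : orthonormal_upto n e -> w != 0 ->
  (forall i, (i < n)%N -> ⟨w, e i⟩ = 0) ->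
  orthonormal_upto n.+1
    (fun i => if (i < n)%N then e i else (Num.sqrt (sqnorm w))^-1%:C%C *: w).
Proof.
move=> on_e w0 we i j; rewrite !ltnS.
set a := (_^-1)%:C%C.
have ew k : (k < n)%N -> ⟨e k, w⟩ = 0.
  by move=> kn; rewrite -inner_conj we// conjC0.
case: ltnP => [lt_in _|le_ni le_in]; case: ltnP => [lt_jn _|le_nj le_jn].
- exact: on_e.
- by rewrite innerZr ew// mulr0 ltn_eqF// (leq_trans lt_in).
- by rewrite innerZl we// mulr0 gtn_eqF// (leq_trans lt_jn).
- have -> : i = n by apply/eqP; rewrite eqn_leq le_in.
  have -> : j = n by apply/eqP; rewrite eqn_leq le_jn.
  rewrite eqxx inner_sqnorm sqnormZ sqmod_real exprVn sqr_sqrtr ?sqnorm_ge0//.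
  by rewrite mulVf// gt_eqF// sqnorm_gt0.
Qed.

Lemma fourier_sum_in (M : set H) n e v : M 0 ->
  (forall a u v, M u -> M v -> M (a *: u + v)) ->
  (forall i, (i < n)%N -> M (e i)) -> M (fourier_sum n e v).
Proof.
move=> M0 Mlin Me; apply: (big_ind M) => // [x y Mx My|i _].
  by rewrite -[x]scale1r; exact: Mlin.
by rewrite -[X in M X]addr0; apply: Mlin => //; exact: Me.
Qed.

(** Finite dimension enters as a bound on the length of orthonormal families: a
    longest family in M spans M, because the normalized residual of a vector of
    M outside of its span would extend it. *)
Lemma orthonormal_basis (M : set H) (N : nat) : M 0 ->
  (forall a u v, M u -> M v -> M (a *: u + v)) ->
  (forall n e, orthonormal_upto n e -> (n <= N)%N) ->
  exists n e, [/\ orthonormal_upto n e, forall i, (i < n)%N -> M (e i) &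
    forall v, M v -> v = fourier_sum n e v].
Proof.
move=> M0 Mlin bdd.
pose P n := exists2 e, orthonormal_upto n e & forall i, (i < n)%N -> M (e i).
have P0 : exists n, `[< P n >] by exists 0%N; apply/asboolP; exists (fun=> 0).
have PN n : `[< P n >] -> (n <= N)%N by move=> /asboolP[e /bdd].
have [n /asboolP[e on_e Me] maxn] := ex_maxnP P0 PN.
exists n, e; split => // v Mv; apply/eqP; rewrite -subr_eq0; apply: contraT => w0.
have Mw : M (v - fourier_sum n e v).
  by rewrite addrC -scaleN1r; apply: (Mlin) => //; exact: fourier_sum_in.
suff /maxn : `[< P n.+1 >] by rewrite ltnn.
apply/asboolP; eexists.
  apply: (orthonormal_extend on_e w0) => i; exact: fourier_residual_orthogonal.
move=> i _ /=; case: ifP => [|_]; first exact: Me.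
by rewrite -[X in M X]addr0; apply: Mlin.
Qed.

Lemma fourier_parseval n e v : orthonormal_upto n e ->
  v = fourier_sum n e v -> \sum_(i < n) sqmod ⟨v, e i⟩ = sqnorm v.
Proof.
move=> on_e ve; apply/esym/eqP; rewrite -subr_eq0 -sqnorm_fourier_residual//.
by rewrite -ve subrr sqnorm_eq0.
Qed.

End orthonormal_families.

(** * Compact quadratic forms attain their maximum *)

Section psd_forms.
Context (R : realType) (H : hilbertType R).
Implicit Types (u v w : H) (Q : H -> R).

(** The parallelogram law stands for the existence of a polar form: it passes
    through integrals directly, and it yields psd_formD and psd_formB. *)
Definition psd_form Q :=
  [/\ forall v, 0 <= Q v,
      forall (a : R[i]) v, Q (a *: v) = sqmod a * Q v &
      forall u v, Q (u + v) + Q (u - v) = 2 * Q u + 2 * Q v].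

Lemma psd_formD Q u v : psd_form Q ->
  Q (u + v) <= 2 * Q u + 2 * Q v.
Proof. by case=> Q0 _ QD; rewrite -QD lerDl. Qed.

Lemma psd_formB Q u v : psd_form Q ->
  Q (u - v) <= 2 * Q u + 2 * Q v.
Proof. by case=> Q0 _ QD; rewrite -QD lerDr. Qed.

(** For l the maximum of Q on the unit sphere, the zeros of the deficit are the
    eigenvectors of Q for l, which makes them accessible without any operator
    representing Q. *)
Lemma psd_form_deficit Q (l : R) : psd_form Q ->
  (forall v, Q v <= l * sqnorm v) ->
  psd_form (fun v => l * sqnorm v - Q v).
Proof.
case=> Q0 QZ QD Ql; split => [v|a v|u v]; first by rewrite subr_ge0.
  by rewrite QZ sqnormZ; ring.
have := sqnorm_parallelogram u v; have := QD u v; nra.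
Qed.

(** The inequality Q (u + v) <= 2 Q u + 2 Q v gives stability under sums, and,
    with the bound by the norm, under limits. *)
Lemma null_closed_subspace Q (C : R) : psd_form Q ->
  (forall v, Q v <= C * sqnorm v) -> closed_subspace [set v | Q v = 0].
Proof.
move=> qQ QC; have [Q0 QZ _] := qQ; split => /=.
- move=> v clv; apply/eqP; rewrite eq_le Q0 andbT; apply/ler_addgt0Pr => e e0.
  rewrite add0r.
  have C0 := normr_ge0 C.
  pose d := e / (2 * (`|C| + 1)).
  have de : 2 * ((`|C| + 1) * d) = e by rewrite /d; field; lra.
  have d0 : 0 < d by rewrite divr_gt0// mulr_gt0//; lra.
  have /clv[w [/= Qw vw]] : nbhs v [set w | sqnorm (v - w) < d].
    by have /cvg_sqnorm /(_ d d0) : nbhs v --> v by [].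
  have -> : v = w + (v - w) by rewrite addrC subrK.
  apply: (le_trans (psd_formD _ _ qQ)); rewrite Qw mulr0 add0r.
  have h1 := QC (v - w); have h2 := sqnorm_ge0 (v - w); have := ler_norm C.
  nra.
- by rewrite -(scale0r (0 : H)) QZ sqmod_real expr0n mul0r.
- move=> a u v Qu Qv; apply/eqP; rewrite eq_le Q0 andbT.
  apply: (le_trans (psd_formD _ _ qQ)).
  by rewrite QZ Qu Qv !mulr0 addr0.
Qed.

End psd_forms.

Section maximum.
Context (R : realType) (H : hilbertType R).
Implicit Types (u v w k : H) (ks : seq H) (Q : H -> R).

(** A bounded real function converges along an ultrafilter, since segments are
    compact. *)
Lemma ultra_oscillation (T : Type) (G : set_system T) (f : T -> R) (M e : R) :
  UltraFilter G -> G [set x | `|f x| <= M] -> 0 < e ->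
  exists2 A, G A & forall x y, A x -> A y -> `|f x - f y| < e.
Proof.
move=> GU GM e0.
have GF : ProperFilter G by exact: ultra_proper.
have GMf : G (f @^-1` `[- M, M]%classic).
  by apply: filterS GM => x fx; rewrite /preimage /= in_itv /= -ler_norml.
have [l [_ fl]] := @segment_compact R (- M) M (f @ G) _ GMf.
have e20 : 0 < e / 2 by rewrite divr_gt0.
exists [set x | `|l - f x| < e / 2].
  have [GA|Gc] := in_ultra_setVsetC [set x | `|l - f x| < e / 2] GU.
    exact: GA.
  have lb : nbhs l (ball l (e / 2)) by exact: nbhsx_ballx.
  have [y []] := fl (~` ball l (e / 2)) _ Gc lb.
  by rewrite /ball /=.
move=> x y /= lx ly; rewrite (splitr e) -(subrKA l).
rewrite (le_lt_trans (ler_normD _ _))//.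
by rewrite ltrD// distrC.
Qed.

Lemma ultra_inner_cauchy (G : set_system H) k (e : R) : UltraFilter G ->
  G [set v | sqnorm v = 1] -> 0 < e ->
  exists2 A, G A & forall v w, A v -> A w -> sqmod ⟨v - w, k⟩ < e.
Proof.
move=> GU G1 e0.
have d0 : 0 < Num.sqrt (e / 2) by rewrite sqrtr_gt0 divr_gt0.
have bound v : sqnorm v = 1 -> sqmod ⟨v, k⟩ <= (sqnorm k + 1) ^+ 2.
  move=> v1; apply: le_trans (cauchy_schwarz _ _) _; rewrite v1.
  have := sqnorm_ge0 k; nra.
have k0 : 0 <= sqnorm k + 1 by rewrite addr_ge0 ?sqnorm_ge0.
have [|A GA Ae] := @ultra_oscillation _ G (fun v => complex.Re ⟨v, k⟩)
    (sqnorm k + 1) _ GU _ d0.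
  apply: filterS G1 => v /= /bound h.
  rewrite -(@ler_pXn2r _ 2)// ?nnegrE// real_normK ?num_real//.
  by apply: le_trans h; rewrite lerDl sqr_ge0.
have [|B GB Be] := @ultra_oscillation _ G (fun v => complex.Im ⟨v, k⟩)
    (sqnorm k + 1) _ GU _ d0.
  apply: filterS G1 => v /= /bound h.
  rewrite -(@ler_pXn2r _ 2)// ?nnegrE// real_normK ?num_real//.
  by apply: le_trans h; rewrite lerDr sqr_ge0.
exists (A `&` B); first exact: filterI.
move=> v w [Av Bv] [Aw Bw]; rewrite /sqmod innerDl innerNl !raddfB /=.
have small (x : R) : `|x| < Num.sqrt (e / 2) -> x ^+ 2 < e / 2.
  move=> xe; rewrite -[x ^+ 2]real_normK ?num_real//.
  rewrite -[e / 2]sqr_sqrtr; last by rewrite divr_ge0// ltW.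
  by rewrite ltr_pXn2r// nnegrE// ltW.
by rewrite (splitr e) ltrD// small// (Ae, Be).
Qed.

Lemma ultra_inner_cauchy_seq (G : set_system H) ks (e : R) : UltraFilter G ->
  G [set v | sqnorm v = 1] -> 0 < e ->
  exists2 A, G A &
    forall v w, A v -> A w -> \sum_(k <- ks) sqmod ⟨v - w, k⟩ < e.
Proof.
move=> GU G1; elim: ks e => [|k ks ih] e e0.
  by exists setT; [exact: filterT|move=> v w _ _; rewrite big_nil].
have e20 : 0 < e / 2 by rewrite divr_gt0.
have [A GA Ae] := ih _ e20.
have [B GB Be] := ultra_inner_cauchy k GU G1 e20.
exists (A `&` B); first exact: filterI.
move=> v w [Av Bv] [Aw Bw]; rewrite big_cons (splitr e).
by rewrite ltrD// (Ae, Be).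
Qed.

(** Compactness of the operator behind Q, as a statement about Q alone: up to an
    arbitrarily small multiple of the norm, Q sees only finitely many
    coordinates. *)
Definition compact_form Q := forall e : R, 0 < e ->
  exists ks (C : R), 0 <= C /\
    forall v, Q v <= e * sqnorm v + C * \sum_(k <- ks) sqmod ⟨v, k⟩.

Lemma compact_form_bounded Q : compact_form Q ->
  exists M : R, forall v, sqnorm v = 1 -> Q v <= M.
Proof.
move=> /(_ 1 ltr01) [ks [C [C0 QC]]].
exists (1 + C * \sum_(k <- ks) sqnorm k) => v v1.
apply: (le_trans (QC v)); rewrite v1 mulr1 lerD2l ler_wpM2l//.
by apply: ler_sum => k _; rewrite (le_trans (cauchy_schwarz _ _))// v1 mul1r.
Qed.

(** An ultrafilter of near-maximisers on the unit sphere is Cauchy in norm, so it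
    converges, by completeness, to a maximiser. This is the spectral theorem for
    the largest eigenvalue of a compact positive operator. *)
Lemma compact_form_max Q v0 : psd_form Q -> compact_form Q -> 0 < Q v0 ->
  exists l : R, [/\ 0 < l, forall v, Q v <= l * sqnorm v &
    exists2 v, v != 0 & Q v = l * sqnorm v].
Proof.
move=> qQ cQ Qv0; have [Q0 QZ QD] := qQ.
have Q00 : Q 0 = 0.
  by rewrite -(scale0r (0 : H)) QZ sqmod_real expr0n mul0r.
have normalize v : v != 0 -> exists w, sqnorm w = 1 /\ Q v = Q w * sqnorm v.
  rewrite -sqnorm_gt0 => v0'.
  exists ((Num.sqrt (sqnorm v))^-1%:C%C *: v).
  rewrite sqnormZ QZ sqmod_real exprVn sqr_sqrtr ?sqnorm_ge0//.
  by rewrite mulVf ?gt_eqF//; split=> //; field; rewrite gt_eqF.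
pose S := [set Q v | v in [set v | sqnorm v = 1]].
have nz v : 0 < Q v -> v != 0.
  by apply: contraTneq => ->; rewrite Q00 ltxx.
have [w0 [w01 Qw0]] := normalize v0 (nz _ Qv0).
have Qw00 : 0 < Q w0.
  have v0_gt0 : 0 < sqnorm v0 by rewrite sqnorm_gt0 nz.
  by rewrite -(pmulr_lgt0 _ v0_gt0) -Qw0.
have supS : has_sup S.
  split; first by exists (Q w0), w0.
  by have [M QM] := compact_form_bounded cQ; exists M => _ [v /= /QM + <-].
pose l := sup S.
have leS w : sqnorm w = 1 -> Q w <= l.
  by move=> w1; apply: sup_upper_bound => //; exists w.
have l0 : 0 < l := lt_le_trans Qw00 (leS _ w01).
have Ql v : Q v <= l * sqnorm v.
  have [->|v0'] := eqVneq v 0; first by rewrite Q00 mulr_ge0 ?sqnorm_ge0 ?ltW.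
  have [w [w1 ->]] := normalize v v0'.
  by rewrite ler_wpM2r ?sqnorm_ge0 ?leS.
exists l; split => //.
have qr := psd_form_deficit qQ Ql.
set r := (fun v => _) in qr.
pose F := filter_from [set d : R | 0 < d]
  (fun d => [set v | sqnorm v = 1 /\ r v < d]).
have FF : ProperFilter F.
  apply: filter_from_proper.
    apply: filter_from_filter; first by exists 1 => /=.
    move=> i j /= i0 j0; exists (Num.min i j) => /=; first by rewrite lt_min i0.
    by move=> v /= [v1]; rewrite lt_min => /andP[vi vj].
  move=> d /= d0; have [_ [v /= v1 <-] ldv] := sup_adherent d0 supS.
  by exists v; split=> //; rewrite /r v1 mulr1 -/l; rewrite -/l in ldv; lra.
have [G [GU FG]] := ultraFilterLemma FF.
have near_max d : 0 < d -> G [set v | sqnorm v = 1 /\ r v < d].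
  by move=> d0; apply: FG; exists d.
have G1 : G [set v | sqnorm v = 1].
  by apply: filterS (near_max 1 ltr01) => v [].
have GF : ProperFilter G by exact: ultra_proper.
(* In l |v - w|^2 = r (v - w) + Q (v - w), the deficit r is small at
   near-maximisers, and compactness bounds Q by l/2 |v - w|^2 plus finitely many
   coordinates, which are Cauchy along an ultrafilter; half of the left-hand side
   absorbs the first term. *)
have [x Gx] : exists x : H, G --> x.
  apply: (cauchy_sqnorm GF) => e e0.
  have l20 : 0 < l / 2 by rewrite divr_gt0.
  have [ks [C [C0 QC]]] := cQ _ l20.
  pose d := l * e / 16.
  have d0 : 0 < d by rewrite /d !mulr_gt0// invr_gt0.
  pose t := l * e / (4 * (C + 1)).
  have Ct : 4 * ((C + 1) * t) = l * e by rewrite /t; field; lra.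
  have t0 : 0 < t by rewrite /t divr_gt0// mulr_gt0//; lra.
  have [A GA At] := ultra_inner_cauchy_seq ks GU G1 t0.
  exists (A `&` [set v | sqnorm v = 1 /\ r v < d]).
    exact: filterI (near_max _ d0).
  move=> v w [Av [v1 rv]] [Aw [w1 rw]].
  have := psd_formB v w qr; have := QC (v - w); have := At v w Av Aw.
  set s := \sum_(k <- ks) _; move=> st Qvw.
  have Cs : C * s <= C * t by rewrite ler_wpM2l// ltW.
  rewrite {1}/r => h; rewrite -(ltr_pM2l l20) /d in rv rw *; nra.
exists x.
  apply/negP => /eqP x0; move: Gx; rewrite x0 => /cvg_sqnorm /(_ 1 ltr01) G0.
  have [v [/= + v1]] := filter_ex (filterI G0 G1).
  by rewrite sub0r -scaleN1r sqnormZ v1 /sqmod /=; lra.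
apply/eqP; rewrite eq_le Ql /= -subr_le0; apply/ler_addgt0Pr => e e0; rewrite add0r.
have d0 : 0 < e / 4 by rewrite divr_gt0.
have t0 : 0 < e / (4 * l) by rewrite divr_gt0// mulr_gt0.
have le4 : l * (e / (4 * l)) = e / 4 by field; rewrite gt_eqF.
move: Gx => /cvg_sqnorm /(_ _ t0) Gt.
have [v [/= xv [v1 rv]]] := filter_ex (filterI Gt (near_max _ d0)).
rewrite -[leLHS]/(r x) -[x in r x](subrK v) addrC.
have := psd_formD v (x - v) qr.
have : r (x - v) <= l * sqnorm (x - v) by rewrite /r gerBl Q0.
have : l * sqnorm (x - v) <= e / 4 by rewrite -le4 ler_wpM2l// ltW.
lra.
Qed.

End maximum.

(** * Integrals of continuous functions on a compact space *)

Section continuous_integral.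
Context (R : realType) (T : ptopologicalType) (T_compact : compact [set: T]).
Context (mu : probability (borel T) R).
Implicit Types (f g : T -> R).

Local Notation "\I f" := (Rintegral mu [set: borel T] f) (at level 10).

Lemma mu_total : mu [set: borel T] = 1%E.
Proof. exact: probability_setT. Qed.

Lemma continuous_measurable_borel f : continuous f ->
  measurable_fun [set: borel T] (f : borel T -> R).
Proof.
move=> /continuousP cf; apply: (measurability _ (RGenOpens.measurableE R)).
move=> _ [_ [a [b ->] <-]]; rewrite setTI.
apply: sub_gen_smallest; exact/cf/interval_open.
Qed.

(** A continuous function on a compact space is bounded, and mu is finite. *)
Lemma continuous_integrable f : continuous f ->
  mu.-integrable [set: borel T] (EFin \o f).
Proof.
move=> cf; apply: measurable_bounded_integrable => //.
- exact: (@eq_ind_r _ _ (fun x => (x < +oo)%E) (ltry _) _ mu_total).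
- exact: continuous_measurable_borel.
- have /compact_bounded[M [_ Mf]] : compact (f @` [set: T]).
    apply: continuous_compact => //; exact: continuous_subspaceT.
  exists M; split; rewrite ?num_real // => y My s _; apply: Mf => //.
Qed.

Lemma continuous_integral f : continuous f ->
  (\int[mu]_(s in [set: borel T]) (f s)%:E = (\I f)%:E)%E.
Proof.
move=> cf; rewrite /Rintegral fineK//.
by apply: integrable_fin_num => //; exact: continuous_integrable.
Qed.

Lemma Rintegral_const (c : R) : \I (fun=> c) = c.
Proof.
rewrite Rintegral_cst// [X in _ * X](_ : _ = 1) ?mulr1//.
exact: (congr1 fine mu_total).
Qed.

Lemma continuous_le_integral f g : continuous f -> continuous g ->
  (forall s, f s <= g s) -> \I f <= \I g.
Proof.
by move=> cf cg fg; apply: le_Rintegral => //; exact: continuous_integrable.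
Qed.

Lemma continuous_integralD f g : continuous f -> continuous g ->
  \I (fun s => f s + g s) = \I f + \I g.
Proof. by move=> cf cg; apply: RintegralD => //; exact: continuous_integrable. Qed.

Lemma continuous_integralZ (c : R) f : continuous f ->
  \I (fun s => c * f s) = c * \I f.
Proof. by move=> cf; apply: RintegralZl => //; exact: continuous_integrable. Qed.

Lemma continuous_sum (I : Type) (r : seq I) (F : I -> T -> R) :
  (forall i, continuous (F i)) -> continuous (fun s => \sum_(i <- r) F i s).
Proof.
move=> cF; elim: r => [|i r ih].
  rewrite [X in continuous X](_ : _ = fun=> 0); first by move=> s; exact: cvg_cst.
  by apply/funext => s; rewrite big_nil.
rewrite [X in continuous X](_ : _ = fun s => F i s + \sum_(i <- r) F i s).
  by move=> s; apply: cvgD; [exact: cF|exact: ih].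
by apply/funext => s; rewrite big_cons.
Qed.

Lemma continuous_integral_sum (I : Type) (r : seq I) (F : I -> T -> R) :
  (forall i, continuous (F i)) ->
  \I (fun s => \sum_(i <- r) F i s) = \sum_(i <- r) \I (F i).
Proof.
move=> cF; elim: r => [|i r ih].
  rewrite big_nil -[RHS](Rintegral_const 0).
  by apply: eq_Rintegral => s _; rewrite big_nil.
rewrite big_cons -ih -continuous_integralD//; last exact: continuous_sum.
by apply: eq_Rintegral => s _; rewrite big_cons.
Qed.

(** The scaling rule for integrals concerns nonnegative functions; it extends to
    f through its positive and negative parts, whose integrals are finite. *)
Lemma integral_mscale_continuous (c : {nonneg R}) f : continuous f ->
  (\int[mscale c mu]_(s in [set: borel T]) (f s)%:E = (c%:num * \I f)%:E)%E.
Proof.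
move=> cf; have mf := continuous_measurable_borel cf.
rewrite integralE !ge0_integral_mscale//.
- rewrite -muleBr//; last first.
    exact: (integrable_add_def measurableT (continuous_integrable cf)).
  by rewrite EFinM -continuous_integral// [in RHS]integralE.
- by apply: measurable_funeneg; exact/measurable_EFinP.
- by apply: measurable_funepos; exact/measurable_EFinP.
Qed.

Lemma integrable_mscale_continuous (c : {nonneg R}) f : continuous f ->
  (mscale c mu).-integrable [set: borel T] (EFin \o f).
Proof.
move=> cf; apply/integrableP; split.
  by apply/measurable_EFinP; exact: continuous_measurable_borel.
have cn : continuous (fun s => `|f s|).
  by move=> s; apply: cvg_norm; exact: cf.
by have := integral_mscale_continuous c cn => /= ->; rewrite ltry.
Qed.

End continuous_integral.

Section translation.
Context (R : realType) (G : topologicalGroupType).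
Context (mu : probability (borel G) R) (mu_haar : haar mu).

Lemma continuous_mulgl (t : G) : continuous (fun s : G => (t * s)%g).
Proof.
move=> s; apply: (@continuous2_cvg _ _ _ _ (nbhs s) _ (fun=> t) id
  (fun x y => (x * y)%g)).
- exact: (@mulg_continuous G (t, s)).
- exact: cvg_cst.
- exact: cvg_id.
Qed.

(** The image of mu under left translation by t is mu itself: the preimage of A is
    the left translate of A by the inverse of t. *)
Lemma haar_translate (f : G -> R) (t : G) : compact [set: G] -> continuous f ->
  Rintegral mu setT (fun s : borel G => f (t * s)%g) = Rintegral mu setT f.
Proof.
move=> G_compact cf.
have mt : measurable_fun [set: borel G] (fun s : borel G => (t * s)%g : borel G).
  apply: (measurability (@open G : set (set (borel G)))) => //.
  move=> _ [U oU <-]; rewrite setTI; apply: sub_gen_smallest.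
  by move/continuousP: (@continuous_mulgl t); apply.
have cft : continuous (fun s : G => f (t * s)%g).
  by move=> s; apply: continuous_comp; [exact: continuous_mulgl|exact: cf].
rewrite /Rintegral; congr fine.
have := @integral_pushforward _ _ _ _ R _ mt mu setT (EFin \o f).
move=> <- //.
- apply: eq_measure_integral => A mA _; rewrite /= /pushforward.
  rewrite -[RHS](mu_haar.1 t^-1%g)//; congr (mu _).
  apply/seteqP; split => s /=.
    by move=> As; exists (t * s)%g => //; rewrite mulKg.
  by move=> [x Ax <-]; rewrite mulVKg.
- by apply/measurable_EFinP; exact: continuous_measurable_borel.
- exact: continuous_integrable.
Qed.

End translation.

(** * The averaged coefficient form of a unitary representation *)

Section complex_continuous.
Context (R : realType) (T : topologicalType).
Implicit Types (f g : T -> R[i]).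

Definition ccontinuous f :=
  continuous (fun s => complex.Re (f s)) /\ continuous (fun s => complex.Im (f s)).

Lemma ccontinuousM f g : ccontinuous f -> ccontinuous g ->
  ccontinuous (fun s => f s * g s).
Proof.
move=> [fr fi] [gr gi]; split.
  rewrite [X in continuous X](_ : _ = fun s => complex.Re (f s) * complex.Re (g s)
      - complex.Im (f s) * complex.Im (g s)); last first.
    by apply/funext => s; case: (f s) (g s) => [a b] [c d].
  by move=> s; apply: cvgB; apply: cvgM;
    (apply: fr || apply: fi || apply: gr || apply: gi).
rewrite [X in continuous X](_ : _ = fun s => complex.Re (f s) * complex.Im (g s)
    + complex.Im (f s) * complex.Re (g s)); last first.
  by apply/funext => s; case: (f s) (g s) => [a b] [c d].
by move=> s; apply: cvgD; apply: cvgM;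
  (apply: fr || apply: fi || apply: gr || apply: gi).
Qed.

Lemma ccontinuous_conj f : ccontinuous f -> ccontinuous (fun s => (f s)^*).
Proof.
move=> [fr fi]; split.
  rewrite [X in continuous X](_ : _ = fun s => complex.Re (f s))//.
  by apply/funext => s; case: (f s).
rewrite [X in continuous X](_ : _ = fun s => - complex.Im (f s)).
  by move=> s; apply: cvgN; exact: fi.
by apply/funext => s; case: (f s).
Qed.

Lemma continuous_sqmod f : ccontinuous f -> continuous (fun s => sqmod (f s)).
Proof.
move=> [fr fi] s; rewrite /sqmod.
under eq_fun do rewrite !expr2.
by apply: cvgD; apply: cvgM; (apply: fr || apply: fi).
Qed.

Lemma ccontinuous_inner (H : hilbertType R) (x : T -> H) (v : H) : continuous x ->
  ccontinuous (fun s => ⟨x s, v⟩).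
Proof.
move=> cx.
have small (s : T) (e : R) : 0 < e ->
    \forall t \near s, sqmod (⟨x s, v⟩ - ⟨x t, v⟩) < e ^+ 2.
  move=> e0; have d0 : 0 < e ^+ 2 / (sqnorm v + 1).
    by rewrite divr_gt0 ?exprn_gt0 // ltr_wpDl// sqnorm_ge0.
  have xs : \forall t \near s, sqnorm (x s - x t) < e ^+ 2 / (sqnorm v + 1).
    by have /cvg_sqnorm/(_ _ d0) := cx s.
  apply: filterS xs => t.
  rewrite -innerNl -innerDl ltr_pdivlMr ?ltr_wpDl ?sqnorm_ge0//.
  move=> h; apply: le_lt_trans h; apply: (le_trans (cauchy_schwarz _ _)).
  by rewrite ler_wpM2l ?sqnorm_ge0// lerDl.
have abs_lt (z e : R) : 0 < e -> z ^+ 2 < e ^+ 2 -> `|z| < e.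
  move=> e0; rewrite -[z ^+ 2]real_normK ?num_real// ltr_pXn2r// nnegrE//.
  exact: ltW.
split=> s; apply/cvgrPdist_lt => e e0; apply: filterS (small s e e0) => t.
  rewrite /sqmod !raddfB /= => h; apply: abs_lt => //.
  by apply: le_lt_trans h; rewrite lerDl sqr_ge0.
rewrite /sqmod !raddfB /= => h; apply: abs_lt => //.
by apply: le_lt_trans h; rewrite lerDr sqr_ge0.
Qed.

End complex_continuous.

Section coefficient_form.
Context (R : realType) (G : topologicalGroupType) (G_compact : compact [set: G]).
Context (mu : probability (borel G) R) (mu_haar : haar mu).
Context (H : hilbertType R) (pi : G -> bounded_op H).
Hypothesis pi_rep : unitary_representation pi.
Implicit Types (u v w : H) (s t : G).

Local Notation "\I f" := (Rintegral mu [set: borel G] f) (at level 10).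

Lemma rep_sqnorm s u : sqnorm (pi s u) = sqnorm u.
Proof. by rewrite /sqnorm; case: pi_rep => _ _ /(_ s)[-> _] _. Qed.

Lemma rep_inner s t u v : ⟨pi t v, pi s u⟩ = ⟨v, pi (t^-1 * s)%g u⟩.
Proof.
case: pi_rep => _ piM piU _; have [piU' _] := piU t.
by rewrite -{1}(mulVKg t s) piM piU'.
Qed.

Lemma coefficient_continuous u v : ccontinuous (fun s => ⟨pi s u, v⟩).
Proof. by apply: ccontinuous_inner; case: pi_rep. Qed.

Lemma coefficient_conj_continuous u v : ccontinuous (fun s => ⟨v, pi s u⟩).
Proof.
rewrite [X in ccontinuous X](_ : _ = fun s => ⟨pi s u, v⟩^*).
  exact/ccontinuous_conj/coefficient_continuous.
by apply/funext => s; rewrite inner_conj.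
Qed.

Lemma coefficient_sqmod_continuous u v : continuous (fun s => sqmod ⟨v, pi s u⟩).
Proof. exact/continuous_sqmod/coefficient_conj_continuous. Qed.

Hint Resolve coefficient_sqmod_continuous : core.

(** This averages over s the rank one form of pi s u; left invariance of mu makes
    it an invariant of the representation. *)
Definition coefficient_form u v : R := \I (fun s => sqmod ⟨v, pi s u⟩).

Lemma coefficient_form_quadratic u : psd_form (coefficient_form u).
Proof.
split=> [v|a v|v w].
- by apply: Rintegral_ge0 => s _; exact: sqmod_ge0.
- rewrite -continuous_integralZ//; apply: eq_Rintegral => s _.
  by rewrite innerZl sqmodM.
- rewrite -!continuous_integralZ// -!continuous_integralD//.
  + by apply: eq_Rintegral => s _; rewrite !innerDl innerNl sqmod_parallelogram.
  + by move=> s; apply: cvgM; [exact: cvg_cst|exact: coefficient_sqmod_continuous].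
  + by move=> s; apply: cvgM; [exact: cvg_cst|exact: coefficient_sqmod_continuous].
Qed.

Lemma coefficient_form_invariant u t v :
  coefficient_form u (pi t v) = coefficient_form u v.
Proof.
rewrite /coefficient_form.
rewrite -(@haar_translate _ _ _ mu_haar (fun s => sqmod ⟨v, pi s u⟩) t^-1%g)//.
by apply: eq_Rintegral => s _; rewrite rep_inner.
Qed.

(** The orbit of u is compact, being a continuous image of G. *)
Lemma orbit_net u (e : R) : 0 < e ->
  exists ts : seq G, forall s, exists2 t, t \in ts & sqnorm (pi s u - pi t u) < e.
Proof.
move=> e0; case: pi_rep => _ _ _ /(_ u) cu.
pose f t := interior [set s | sqnorm (pi t u - pi s u) < e].
move: G_compact; rewrite compact_cover.
move=> /(_ G setT f) [t _||D _ Df]; first exact: open_interior.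
  move=> t _; exists t => //; rewrite /f /interior.
  by have /cvg_sqnorm/(_ e e0) := cu t.
exists (finmap.enum_fset D) => s; have [t Dt] := Df s I.
move=> /interior_subset /= st; exists t => //.
by rewrite -opprB -scaleN1r sqnormZ /sqmod /= oppr0 expr0n addr0 sqrrN expr1n mul1r.
Qed.

(** Replacing pi s u by a nearby point of a net of the orbit changes its coefficient
    at v by a small multiple of |v|, uniformly in s. *)
Lemma coefficient_form_compact u : compact_form (coefficient_form u).
Proof.
move=> e e0; have e20 : 0 < e / 2 by rewrite divr_gt0.
have [ts tsP] := orbit_net u e20.
exists [seq pi t u | t <- ts], 2; split => // v.
rewrite -[leRHS](Rintegral_const mu).
apply: continuous_le_integral => // [|s]; first by move=> s; exact: cvg_cst.
have [t tts st] := tsP s.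
rewrite -[pi s u](subrK (pi t u)) innerDr.
have := sqmod_parallelogram ⟨v, pi s u - pi t u⟩ ⟨v, pi t u⟩.
have := sqmod_ge0 (⟨v, pi s u - pi t u⟩ - ⟨v, pi t u⟩).
have := cauchy_schwarz v (pi s u - pi t u).
have : sqmod ⟨v, pi t u⟩ <= \sum_(k <- [seq pi t u | t <- ts]) sqmod ⟨v, k⟩.
  rewrite big_map (big_rem t)//= lerDl.
  by apply: sumr_ge0 => ? _; exact: sqmod_ge0.
have : sqnorm v * sqnorm (pi s u - pi t u) <= sqnorm v * (e / 2).
  by rewrite ler_wpM2l ?sqnorm_ge0// ltW.
lra.
Qed.

(** Every point of the orbit is close to some point pi t u of a net, hence far from
    orthogonal to it. The integrands of the forms at the points of the net thus
    have a sum bounded below by a positive constant. *)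
Lemma coefficient_form_neq0 u : u != 0 -> exists v, 0 < coefficient_form u v.
Proof.
rewrite -sqnorm_gt0 => u0; have [ts tsP] := orbit_net u u0.
have qge0 v : 0 <= coefficient_form u v by case: (coefficient_form_quadratic u).
suff : 0 < \sum_(t <- ts) coefficient_form u (pi t u).
  move=> sum_gt0; apply: contrapT => /forallNP q0; move: sum_gt0.
  rewrite big1 ?ltxx// => t _; apply/eqP; rewrite eq_le qge0 andbT leNgt.
  exact/negP.
rewrite -continuous_integral_sum//.
have c0 : 0 < sqnorm u ^+ 2 / 4 by rewrite divr_gt0// exprn_gt0.
apply: (lt_le_trans c0); rewrite -[leLHS](Rintegral_const mu).
apply: continuous_le_integral => // [||s]; first by move=> s; exact: cvg_cst.
  exact: continuous_sum.
have [t tts] := tsP s; rewrite -opprB -scaleN1r sqnormZ => st.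
apply: (@le_trans _ _ (sqmod ⟨pi t u, pi s u⟩)); last first.
  rewrite (big_rem t)//= lerDl.
  by apply: sumr_ge0 => ? _; exact: sqmod_ge0.
move: st; rewrite /sqmod /= oppr0 expr0n addr0 sqrrN expr1n mul1r.
rewrite sqnormB_Re !rep_sqnorm.
move: (complex.Re _) (complex.Im _) => a b; nra.
Qed.

(** Apply the Bessel inequality to pi s u for each s, then integrate; all these
    vectors have the norm of u. *)
Lemma coefficient_form_bessel u n (e : nat -> H) : orthonormal_upto n e ->
  \sum_(i < n) coefficient_form u (e i) <= sqnorm u.
Proof.
move=> on_e; rewrite -continuous_integral_sum// -[leRHS](Rintegral_const mu).
apply: continuous_le_integral => // [||s].
- exact: continuous_sum.
- by move=> s; exact: cvg_cst.
- rewrite -(rep_sqnorm s u); apply: le_trans (bessel _ on_e).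
  by apply: ler_sum => i _; rewrite -[⟨pi s u, _⟩]inner_conj sqmod_conj.
Qed.

Lemma coefficient_form_parseval u n (e : nat -> H) : orthonormal_upto n e ->
  (forall v, v = fourier_sum n e v) ->
  \sum_(i < n) coefficient_form u (e i) = sqnorm u.
Proof.
move=> on_e eH; rewrite -continuous_integral_sum// -[RHS](Rintegral_const mu).
apply: eq_Rintegral => s _; rewrite -(rep_sqnorm s u).
rewrite -(fourier_parseval on_e (eH (pi s u))).
by apply: eq_bigr => i _; rewrite -[⟨pi s u, _⟩]inner_conj sqmod_conj.
Qed.

(** Schur lemma for the coefficient form: its maximum l is attained, so the null
    space of the deficit is a nonzero closed subspace. It is invariant, hence
    everything. *)
Lemma irreducible_coefficient_form u : irreducible pi -> u != 0 ->
  exists2 l : R, 0 < l & forall v, coefficient_form u v = l * sqnorm v.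
Proof.
move=> pi_irr u0; have qq := coefficient_form_quadratic u.
have [v0 qv0] := coefficient_form_neq0 u0.
have [l [l0 ql [x x0 qx]]] := compact_form_max qq (coefficient_form_compact u) qv0.
exists l => // v.
have qr := psd_form_deficit qq ql.
have rl w : l * sqnorm w - coefficient_form u w <= l * sqnorm w.
  by rewrite gerBl; case: qq.
have [|M0|MT] := pi_irr _ (null_closed_subspace qr rl).
- by move=> s w /=; rewrite coefficient_form_invariant rep_sqnorm.
- have : [set w | l * sqnorm w - coefficient_form u w = 0] x by rewrite /= qx subrr.
  by rewrite M0 /= => x00; rewrite x00 eqxx in x0.
- have : [set w | l * sqnorm w - coefficient_form u w = 0] v by rewrite MT.
  by move=> /= /eqP; rewrite subr_eq0 => /eqP.
Qed.

(** The form takes the value l on each unit vector, whereas its values on an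
    orthonormal family add up to at most |u|^2. *)
Lemma orthonormal_bounded u (l : R) : 0 < l ->
  (forall v, coefficient_form u v = l * sqnorm v) ->
  exists N, forall n (e : nat -> H), orthonormal_upto n e -> (n <= N)%N.
Proof.
move=> l0 ql; exists (Num.truncn (sqnorm u / l)) => n e on_e.
rewrite truncn_ge_nat; last by rewrite divr_ge0 ?sqnorm_ge0// ltW.
rewrite ler_pdivlMr//; apply: le_trans (coefficient_form_bessel u on_e).
rewrite (eq_bigr (fun=> l)); last first.
  by move=> i _; rewrite ql /sqnorm on_e// eqxx mulr1.
by rewrite sumr_const card_ord mulr_natl.
Qed.

End coefficient_form.

(** * From the diagonal relation to the square integrability identity *)

Section polarization.
Context (R : realType) (H : hilbertType R).

(** Vanishing on the diagonal makes B alternating; comparing B u v with B u (i v)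
    makes it symmetric as well. *)
Lemma sesquilinear_eq0 (B : H -> H -> R[i]) :
  (forall u v w, B (u + v) w = B u w + B v w) ->
  (forall u v w, B u (v + w) = B u v + B u w) ->
  (forall u v, B ('i%C *: u) v = 'i%C * B u v) ->
  (forall u v, B u ('i%C *: v) = - ('i%C * B u v)) ->
  (forall u, B u u = 0) -> forall u v, B u v = 0.
Proof.
move=> BDl BDr BZl BZr B0 u v.
have skew x y : B x y + B y x = 0.
  by have := B0 (x + y); rewrite BDl !BDr !B0 add0r addr0.
have : 'i%C * (- B u v + B v u) = 0.
  by rewrite mulrDr mulrN -BZr -BZl skew.
move/eqP; rewrite mulf_eq0 eq_complex /= oner_eq0 andbF /= => h.
have /eqP := skew u v; have -> : B v u = B u v.
  by apply/eqP; rewrite -subr_eq0 addrC.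
by rewrite -mulr2n mulrn_eq0 /= => /eqP.
Qed.

End polarization.

Section continuous_cintegral.
Context (R : realType) (T : ptopologicalType) (T_compact : compact [set: T]).
Context (mu : probability (borel T) R).
Implicit Types (f g : T -> R[i]).

Local Notation "\I f" := (Rintegral mu [set: borel T] f) (at level 10).

Definition cint f : R[i] :=
  Complex (\I (fun s => complex.Re (f s))) (\I (fun s => complex.Im (f s))).

Lemma cintD f g : ccontinuous f -> ccontinuous g ->
  cint (fun s => f s + g s) = cint f + cint g.
Proof.
move=> [fr fi] [gr gi]; apply/eqP; rewrite eq_complex /=.
rewrite -!continuous_integralD//.
by apply/andP; split; apply/eqP; apply: eq_Rintegral => s _; rewrite raddfD.
Qed.

Lemma cint_i f : ccontinuous f -> cint (fun s => 'i%C * f s) = 'i%C * cint f.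
Proof.
move=> [fr fi]; apply/eqP; rewrite eq_complex /=; apply/andP; split; apply/eqP.
  transitivity (\I (fun s => -1 * complex.Im (f s))).
    by apply: eq_Rintegral => s _; case: (f s) => a b /=; ring.
  by rewrite continuous_integralZ//; ring.
transitivity (\I (fun s => complex.Re (f s))); last by ring.
by apply: eq_Rintegral => s _; case: (f s) => a b /=; ring.
Qed.

Lemma cint_sqmod f : ccontinuous f ->
  cint (fun s => f s * (f s)^*) = (\I (fun s => sqmod (f s)))%:C%C.
Proof.
move=> cf; apply/eqP; rewrite eq_complex /=; apply/andP; split; apply/eqP.
  by apply: eq_Rintegral => s _; rewrite -sqmodE.
rewrite -[RHS](Rintegral_const mu).
by apply: eq_Rintegral => s _; rewrite -sqmodE.
Qed.

End continuous_cintegral.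

Section orthogonality_relations.
Context (R : realType) (G : topologicalGroupType) (G_compact : compact [set: G]).
Context (mu : probability (borel G) R) (mu_haar : haar mu).
Context (H : hilbertType R) (pi : G -> bounded_op H).
Hypothesis pi_rep : unitary_representation pi.
Implicit Types (u v w : H) (s t : G).

(** The constant n is the dimension of H. By the Schur lemma the form of u is a
    multiple l of the squared norm, and summing it over an orthonormal basis gives
    n l on the one hand and, by Parseval, |u|^2 on the other. *)
Lemma irreducible_schur_relation : irreducible pi -> (exists u : H, u != 0) ->
  exists n : nat, (0 < n)%N /\ forall u v,
    n%:R * coefficient_form mu pi u v = sqnorm u * sqnorm v.
Proof.
move=> pi_irr [u0 u00].
have schur u := irreducible_coefficient_form G_compact mu_haar pi_rep (u := u) pi_irr.
have [l0 l00 ql0] := schur u0 u00.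
have [N bdd] := orthonormal_bounded G_compact pi_rep l00 ql0.
have [|n [e [on_e _ eH]]] := @orthonormal_basis _ H setT N I _ bdd; first by [].
have dimE u (l : R) : (forall v, coefficient_form mu pi u v = l * sqnorm v) ->
    n%:R * l = sqnorm u.
  move=> ql; rewrite -(coefficient_form_parseval G_compact mu pi_rep u on_e)//.
    rewrite (eq_bigr (fun=> l)); first by rewrite sumr_const card_ord mulr_natl.
    by move=> i _; rewrite ql /sqnorm on_e// eqxx mulr1.
  by move=> v; exact: eH.
exists n; split.
  rewrite lt0n; apply: contraNneq u00 => n0.
  by rewrite -sqnorm_eq0 -(dimE _ _ ql0) n0 mul0r.
move=> u v; have [->|u0'] := eqVneq u 0.
  have -> : coefficient_form mu pi 0 v = 0.
    rewrite -[RHS](Rintegral_const mu); apply: eq_Rintegral => s _.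
    by rewrite linear0 -inner_conj inner0l sqmod_conj (sqmod_real 0) expr0n.
  by rewrite mulr0 /sqnorm inner0l mul0r.
have [l _ ql] := schur u u0'.
by rewrite ql mulrA (dimE u l).
Qed.

(** The relation forces finite dimension, so M has a finite orthonormal basis and
    every x has an orthogonal projection on M. If u is a nonzero vector of M, the
    residual of x is orthogonal to the whole orbit of u, and the relation
    gives |u|^2 |residual|^2 = 0. *)
Lemma schur_relation_irreducible (a : R) : 0 < a ->
  (forall u v, coefficient_form mu pi u v = a * sqnorm u * sqnorm v) ->
  irreducible pi.
Proof.
move=> a0 qa M [_ M0 Mlin] Minv.
have [|/existsNP[u /not_implyP[Mu u0]]] := pselect (forall u, M u -> u = 0).
  by move=> Mz; left; apply/seteqP; split => [u /Mz//|u /= ->].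
right; apply/seteqP; split => // x _.
have u_gt0 : 0 < sqnorm u by rewrite sqnorm_gt0; exact/eqP.
have [N bdd] := orthonormal_bounded G_compact pi_rep (mulr_gt0 a0 u_gt0) (qa u).
have [n [e [on_e Me eM]]] := orthonormal_basis M0 Mlin bdd.
have w_orth m : M m -> ⟨x - fourier_sum n e x, m⟩ = 0.
  move=> /eM ->; rewrite -inner_conj inner_fourier_sum big1 ?conjC0// => i _.
  by rewrite -[⟨e i, _⟩]inner_conj fourier_residual_orthogonal// conjC0 mulr0.
have : coefficient_form mu pi u (x - fourier_sum n e x) = 0.
  rewrite -[RHS](Rintegral_const mu); apply: eq_Rintegral => s _.
  by rewrite w_orth ?(sqmod_real 0) ?expr0n//; exact: Minv.
rewrite qa => /eqP; rewrite mulf_eq0 gt_eqF ?mulr_gt0//= sqnorm_eq0 subr_eq0.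
move=> /eqP ->; exact: fourier_sum_in.
Qed.

Definition coefficient_product u1 u2 v1 v2 s : R[i] :=
  ⟨pi s u1, v1⟩ * ⟨v2, pi s u2⟩.

Lemma coefficient_product_continuous u1 u2 v1 v2 :
  ccontinuous (coefficient_product u1 u2 v1 v2).
Proof.
apply: ccontinuousM; first exact: coefficient_continuous.
exact: coefficient_conj_continuous.
Qed.

(** Polarize twice: in the pair (u1, u2), with v1 = v2, then in the pair (v2, v1). *)
Lemma polarized_schur_relation (c : R) :
  (forall u v, c * coefficient_form mu pi u v = sqnorm u * sqnorm v) ->
  forall u1 u2 v1 v2, c%:C%C * cint mu (coefficient_product u1 u2 v1 v2) =
    ⟨u1, u2⟩ * ⟨v2, v1⟩.
Proof.
move=> qc; have cp := coefficient_product_continuous.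
have ii : 'i%C * 'i%C = -1 :> R[i] by rewrite -expr2 sqr_i.
have conji : ('i%C : R[i])^* = - 'i%C.
  by apply/eqP; rewrite eq_complex /= oppr0 !eqxx.
have cancel (x : R[i]) : 'i%C * (- 'i%C * x) = x.
  by rewrite mulrA mulrN ii opprK mul1r.
have anti (x y : R[i]) : 'i%C * x = y -> x = - ('i%C * y).
  by move=> <-; rewrite mulrA ii mulN1r opprK.
have diag u1 u2 v : c%:C%C * cint mu (coefficient_product u1 u2 v v) =
    ⟨u1, u2⟩ * ⟨v, v⟩.
  apply/eqP; rewrite -subr_eq0; apply/eqP; move: u1 u2.
  apply: sesquilinear_eq0 => [u v1 w|u v1 w|u v1|u v1|u].
  - rewrite [coefficient_product _ _ _ _](_ : _ = fun s =>
      coefficient_product u w v v s + coefficient_product v1 w v v s).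
      rewrite cintD// innerDl; ring.
    by apply/funext => s; rewrite /coefficient_product linearD innerDl mulrDl.
  - rewrite [coefficient_product _ _ _ _](_ : _ = fun s =>
      coefficient_product u v1 v v s + coefficient_product u w v v s).
      rewrite cintD// innerDr; ring.
    by apply/funext => s; rewrite /coefficient_product linearD innerDr mulrDr.
  - rewrite [coefficient_product _ _ _ _](_ : _ = fun s =>
      'i%C * coefficient_product u v1 v v s).
      rewrite cint_i// innerZl; ring.
    by apply/funext => s; rewrite /coefficient_product linearZ innerZl mulrA.
  - rewrite innerZr conji.
    rewrite (anti (cint mu _) (cint mu (coefficient_product u v1 v v))).
      ring.
    rewrite -cint_i//; congr cint; apply/funext => s.
    by rewrite /coefficient_product linearZ innerZr conji mulrCA cancel.
  - rewrite [coefficient_product _ _ _ _](_ : _ = fun s =>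
        ⟨v, pi s u⟩ * ⟨v, pi s u⟩^*).
      rewrite cint_sqmod; last exact: coefficient_conj_continuous.
      by rewrite -rmorphM /= -/(coefficient_form mu pi u v) qc !inner_sqnorm
         rmorphM subrr.
    by apply/funext => s; rewrite /coefficient_product inner_conj mulrC.
move=> u1 u2 v1 v2.
apply/eqP; rewrite -subr_eq0; apply/eqP; move: v2 v1.
apply: sesquilinear_eq0 => [u v w|u v w|u v|u v|u].
- rewrite [coefficient_product _ _ _ _](_ : _ = fun s =>
    coefficient_product u1 u2 w u s + coefficient_product u1 u2 w v s).
    rewrite cintD// innerDl; ring.
  by apply/funext => s; rewrite /coefficient_product innerDl mulrDr.
- rewrite [coefficient_product _ _ _ _](_ : _ = fun s =>
    coefficient_product u1 u2 v u s + coefficient_product u1 u2 w u s).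
    rewrite cintD// innerDr; ring.
  by apply/funext => s; rewrite /coefficient_product innerDr mulrDl.
- rewrite [coefficient_product _ _ _ _](_ : _ = fun s =>
    'i%C * coefficient_product u1 u2 v u s).
    rewrite cint_i// innerZl; ring.
  by apply/funext => s; rewrite /coefficient_product innerZl mulrCA.
- rewrite innerZr conji.
  rewrite (anti (cint mu _) (cint mu (coefficient_product u1 u2 v u))).
    ring.
  rewrite -cint_i//; congr cint; apply/funext => s.
  by rewrite /coefficient_product innerZr conji -[_ * _ * _]mulrA cancel.
- by rewrite diag subrr.
Qed.

(** Coefficients are continuous functions on a compact space, so measurability and
    integrability are automatic, and SQ reduces to the values of the integrals. *)
Lemma SQ_mscaleE (c : {posnum R}) :
  SQ (mscale (c%:num)%:nng mu) (fun s : borel G => Some (pi s)) <->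
  forall u1 u2 v1 v2, (c%:num)%:C%C * cint mu (coefficient_product u1 u2 v1 v2) =
    ⟨u1, u2⟩ * ⟨v2, v1⟩.
Proof.
have domT : domain (fun s : borel G => Some (pi s)) = setT by apply/seteqP; split.
rewrite /SQ /= domT; split=> [[_ _ _ int_pi] u1 u2 v1 v2|int_pi].
  have [_ _] := int_pi u1 u2 v1 v2.
  have [cr ci] := coefficient_product_continuous u1 u2 v1 v2.
  rewrite (integral_mscale_continuous G_compact _ _ cr).
  rewrite (integral_mscale_continuous G_compact _ _ ci) => -[re] -[im].
  by apply/eqP; rewrite eq_complex /= !mul0r subr0 addr0 re im !eqxx.
split => [||u v|u1 u2 v1 v2].
- exact: measurableT.
- by rewrite setCT measure0.
- have [cr ci] := coefficient_continuous pi_rep u v.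
  by split; exact: continuous_measurable_borel.
- have [cr ci] := coefficient_product_continuous u1 u2 v1 v2.
  have /eqP := int_pi u1 u2 v1 v2.
  rewrite eq_complex /= !mul0r subr0 addr0 => /andP[/eqP re /eqP im].
  split.
  + exact: integrable_mscale_continuous.
  + exact: integrable_mscale_continuous.
  + by rewrite -re; exact: (integral_mscale_continuous G_compact _ _ cr).
  + by rewrite -im; exact: (integral_mscale_continuous G_compact _ _ ci).
Qed.

End orthogonality_relations.

Theorem corollary2p5 (R : realType) (Sigma : topologicalGroupType)
    (Sigma_compact : compact [set: Sigma])
    (Sigma_hausdorff : hausdorff_space Sigma)
    (mu : probability (borel Sigma) R) (mu_haar : haar mu)
    (H : hilbertType R) (H_neq0 : exists u : H, u != 0)
    (pi : Sigma -> bounded_op H) (pi_rep : unitary_representation pi) :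
  (exists c : {posnum R},
     SQ (mscale (c%:num)%:nng mu) (fun s : borel Sigma => Some (pi s)))
  <-> irreducible pi.
Proof.
split=> [[c /(SQ_mscaleE Sigma_compact mu pi_rep) rel]|pi_irr].
  apply: (@schur_relation_irreducible _ _ Sigma_compact mu _ _ pi_rep c%:num^-1).
    by rewrite invr_gt0.
  move=> u v; have := rel u u v v.
  rewrite [coefficient_product _ _ _ _ _](_ : _ = fun s =>
      ⟨v, pi s u⟩ * ⟨v, pi s u⟩^*); last first.
    by apply/funext => s; rewrite /coefficient_product inner_conj mulrC.
  rewrite cint_sqmod; last exact: coefficient_conj_continuous.
  rewrite !inner_sqnorm -!rmorphM /= => /complexI relR.
  by rewrite -mulrA -relR mulrA mulVf ?mul1r// gt_eqF.
have [n [n0 rel]] :=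
  irreducible_schur_relation Sigma_compact mu_haar pi_rep pi_irr H_neq0.
have n0R : 0 < n%:R :> R by rewrite ltr0n.
exists (PosNum n0R); apply/(SQ_mscaleE Sigma_compact mu pi_rep) => u1 u2 v1 v2.
exact: polarized_schur_relation.
Qed.
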